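(* Let $n\geq 2$, let $\gamma$ be an orientation preserving isometry of the ball model $\mathbb{B}^n$ of hyperbolic $n$-space with $\gamma(0)\neq 0$, and let $\Sigma_\gamma$ be its isometric sphere. Then $\Sigma_\gamma$ is the bisector of the geodesic segment linking the origin $0$ and $\gamma^{-1}(0)$, that is, $$\Sigma_\gamma\cap\mathbb{B}^n=\{u\in\mathbb{B}^n : \rho(0,u)=\rho(u,\gamma^{-1}(0))\}.$$
   Context: $\mathbb{B}^n$ is the open unit ball in $\mathbb{R}^n$ with the hyperbolic metric, and $\rho$ is the hyperbolic distance. An isometry $\gamma$ of $\mathbb{B}^n$ extends to a Möbius transformation of $\mathbb{R}^n\cup\{\infty\}$. If $\gamma(0)\neq0$, then $\gamma(\infty)\neq\infty$, and the isometric sphere $\Sigma_\gamma$ is the Euclidean sphere, orthogonal to the unit sphere $S^{n-1}$, on which $\gamma$ acts as a Euclidean isometry (the set of $x\in\mathbb{R}^n$ where the conformal factor of $\gamma$ equals $1$). Equivalently, $\gamma=A\sigma$, where $\sigma$ is the reflection (inversion) in $\Sigma_\gamma$ and $A$ is a linear orthogonal map. *)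

(* Defs.v *)
From HB Require Import structures.
From mathcomp Require Import all_boot all_order all_algebra.
From mathcomp Require Import all_classical all_reals all_analysis.

Set Implicit Arguments.
Unset Strict Implicit.
Unset Printing Implicit Defensive.

Import Order.TTheory GRing.Theory Num.Theory.
Import numFieldNormedType.Exports.

Local Open Scope classical_set_scope.
Local Open Scope ring_scope.

Section euclidean.
Context {R : realType} {n : nat}.
Implicit Types x y : 'rV[R]_n.

Definition dotv x y : R := \sum_(i < n) x 0 i * y 0 i.

(* The norm [`|x|] that the library puts on ['rV[R]_n] is the sup norm; it
   induces the same topology and the same differentials as this one. *)
Definition enorm x : R := Num.sqrt (dotv x x).

Definition unit_ball : set 'rV[R]_n := [set x | enorm x < 1].

End euclidean.

Section hyperbolic_ball.
Context {R : realType} {n : nat}.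

(* Meaningful for [1 <= t]. *)
Definition arcosh (t : R) : R := ln (t + Num.sqrt (t ^+ 2 - 1)).

(* The distance of the metric 2|dx| / (1 - |x|^2), of curvature -1.
   Meaningful for [x] and [y] in the unit ball. *)
Definition hdist (x y : 'rV[R]_n) : R :=
  arcosh (1 + 2 * enorm (x - y) ^+ 2
                / ((1 - enorm x ^+ 2) * (1 - enorm y ^+ 2))).

(* Only the values of [f] on the unit ball matter. *)
Definition hyp_isometry (f : 'rV[R]_n -> 'rV[R]_n) : Prop :=
  set_bij unit_ball unit_ball f /\
  {in unit_ball &, forall x y, hdist (f x) (f y) = hdist x y}.

(* Isometries of the ball are smooth, so the Jacobian matrix is a genuine one;
   the ball is open, so it depends only on the restriction of [f] to it. *)
Definition orientation_preserving (f : 'rV[R]_n -> 'rV[R]_n) : Prop :=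
  {in unit_ball, forall x, 0 < \det (jacobian f x)}.

End hyperbolic_ball.

Section mobius.
Context {R : realType} {n : nat}.
Local Notation E := 'rV[R]_n.
(* [None] is the point at infinity. *)
Local Notation Ehat := (one_point_compactification E).

Definition sphere_inversion (a : E) (r : R) (z : Ehat) : Ehat :=
  match z with
  | Some x => if x == a then None
              else Some (a + (r / enorm (x - a)) ^+ 2 *: (x - a))
  | None => Some a
  end.

(* Reflection in the hyperplane [dotv x a = t], for a unit vector [a]. *)
Definition hyperplane_reflection (a : E) (t : R) (z : Ehat) : Ehat :=
  match z with
  | Some x => Some (x + (2 * (t - dotv x a)) *: a)
  | None => None
  end.

Inductive mobius : (Ehat -> Ehat) -> Prop :=
| mobius_id : mobius id
| mobius_sphere a r g :
    0 < r -> mobius g -> mobius (sphere_inversion a r \o g)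
| mobius_hyperplane a t g :
    enorm a = 1 -> mobius g -> mobius (hyperplane_reflection a t \o g).

Definition mobius_extension (f : E -> E) (g : Ehat -> Ehat) : Prop :=
  mobius g /\ {in unit_ball, forall x, g (Some x) = Some (f x)}.

(* The value of [g] in the finite part; the default [0] at poles is harmless
   because [conformal_factor_at] asks that [x] not be a pole. *)
Definition finite_part (g : Ehat -> Ehat) (x : E) : E := odflt 0 (g (Some x)).

(* [g] is finite and differentiable at [x], and its differential there scales
   Euclidean lengths by [k]. *)
Definition conformal_factor_at (g : Ehat -> Ehat) (x : E) (k : R) : Prop :=
  [/\ g (Some x) <> None,
      differentiable (finite_part g) x
    & forall v : E, enorm ('d (finite_part g) x v) = k * enorm v].

(* For [1 < n] an isometry of the ball has exactly one Mobius extension. *)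
Definition isometric_sphere (f : E -> E) : set E :=
  [set x | exists2 g, mobius_extension f g & conformal_factor_at g x 1].

End mobius.

(* Main.v *)
(* Let p = gamma^-1(0). Since rho(u, p) = rho(gamma u, 0), a point u of the ball
   lies on the bisector iff |gamma u| = |u|. Letting two points of the ball merge
   in the identity rho(gamma x, gamma y) = rho(x, y) gives
   |d gamma_u v| / (1 - |gamma u|^2) = |v| / (1 - |u|^2), so |gamma u| = |u| iff
   the conformal factor of gamma at u is 1. It remains to see that gamma has a
   Mobius extension: if sigma is the inversion that exchanges 0 and p, then
   gamma o sigma is an isometry fixing 0, hence preserves inner products and is
   a product of linear reflections (Cartan-Dieudonne). *)
Require Import Defs.
From HB Require Import structures.
From mathcomp Require Import all_boot all_order all_algebra.
From mathcomp Require Import all_classical all_reals all_analysis.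
From mathcomp Require Import ring lra.

Set Implicit Arguments.
Unset Strict Implicit.
Unset Printing Implicit Defensive.

Import Order.TTheory GRing.Theory Num.Theory.
Import numFieldNormedType.Exports.

Local Open Scope classical_set_scope.
Local Open Scope ring_scope.

(** * Algebra and continuity of the Euclidean inner product *)

Section dot_product.
Context {R : realType} {n : nat}.
Implicit Types (x y z : 'rV[R]_n) (A : 'M[R]_n).

Lemma dotv_mulmx x y : dotv x y = (x *m y^T) 0 0.
Proof. by rewrite mxE; apply: eq_bigr => i _; rewrite mxE. Qed.

Lemma dotvC x y : dotv x y = dotv y x.
Proof. by apply: eq_bigr => i _; rewrite mulrC. Qed.

Lemma dotvDl x y z : dotv (x + y) z = dotv x z + dotv y z.
Proof. by rewrite !dotv_mulmx mulmxDl mxE. Qed.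

Lemma dotvZl k x y : dotv (k *: x) y = k * dotv x y.
Proof. by rewrite !dotv_mulmx -scalemxAl mxE. Qed.

Lemma dotvNl x y : dotv (- x) y = - dotv x y.
Proof. by rewrite -scaleN1r dotvZl mulN1r. Qed.

Lemma dotvDr x y z : dotv x (y + z) = dotv x y + dotv x z.
Proof. by rewrite dotvC dotvDl !(dotvC x). Qed.

Lemma dotvZr k x y : dotv x (k *: y) = k * dotv x y.
Proof. by rewrite dotvC dotvZl dotvC. Qed.

Lemma dotvNr x y : dotv x (- y) = - dotv x y.
Proof. by rewrite dotvC dotvNl dotvC. Qed.

Definition dotvE := (dotvDl, dotvDr, dotvZl, dotvZr, dotvNl, dotvNr).

Lemma dot0v x : dotv 0 x = 0.
Proof. by rewrite -(scale0r x) dotvZl mul0r. Qed.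

Lemma dotv_ge0 x : 0 <= dotv x x.
Proof. by apply: sumr_ge0 => i _; rewrite -expr2 sqr_ge0. Qed.

Lemma dotv_eq0 x : (dotv x x == 0) = (x == 0).
Proof.
apply/idP/eqP => [|->]; last by rewrite dot0v.
rewrite psumr_eq0 => [/allP h|i _]; last by rewrite -expr2 sqr_ge0.
apply/rowP => i; have := h i (mem_index_enum i).
by rewrite -expr2 sqrf_eq0 mxE => /eqP.
Qed.

Lemma dotv_gt0 x : (0 < dotv x x) = (x != 0).
Proof. by rewrite lt_neqAle eq_sym dotv_eq0 dotv_ge0 andbT. Qed.

Lemma enorm_sqr x : enorm x ^+ 2 = dotv x x.
Proof. by rewrite sqr_sqrtr ?dotv_ge0. Qed.

Lemma enorm_ge0 x : 0 <= enorm x.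
Proof. exact: sqrtr_ge0. Qed.

Lemma unit_ballE x : unit_ball x = (dotv x x < 1) :> Prop.
Proof.
by rewrite /unit_ball /= -enorm_sqr expr_lt1 ?enorm_ge0.
Qed.

Lemma unit_ball0 : unit_ball (0 : 'rV[R]_n).
Proof. by rewrite unit_ballE dot0v ltr01. Qed.

Lemma dotv_delta x i : dotv x (delta_mx 0 i) = x 0 i.
Proof.
rewrite /dotv (bigD1 i) //= mxE !eqxx mulr1 big1 ?addr0 // => j /negPf ji.
by rewrite mxE ji andbF mulr0.
Qed.

Definition isometry_mx A := forall x y, dotv (x *m A) (y *m A) = dotv x y.

Lemma isometry_unitmx A : isometry_mx A -> A \in unitmx.
Proof.
move=> iA; rewrite -row_free_unit; apply/inj_row_free => x xA.
by apply/eqP; rewrite -dotv_eq0 -iA xA dot0v.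
Qed.

Lemma cvg_dotv {T : Type} (F : set_system T) {FF : Filter F}
    (f g : T -> 'rV[R]_n) x y :
  f @ F --> x -> g @ F --> y ->
  (fun t => dotv (f t) (g t)) @ F --> dotv x y.
Proof.
move=> fx gy; apply: (cvg_big (U := R) (op := +%R)) => [|i].
  exact: add_continuous.
have coord (h : T -> 'rV[R]_n) z :
    h @ F --> z -> (fun t => h t 0 i) @ F --> z 0 i.
  move=> hz; exact: (cvg_comp _ _ hz (@coord_continuous R _ _ 0 i z)).
move=> _; exact: (cvgM (coord _ _ fx) (coord _ _ gy)).
Qed.

End dot_product.

(** * Equality of hyperbolic distances as a polynomial identity *)

Section hyperbolic_distance.
Context {R : realType} {n : nat}.
Implicit Types (x y : 'rV[R]_n) (f : 'rV[R]_n -> 'rV[R]_n).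

(** The argument of [ln] is positive and strictly increasing for [1 <= t]. *)
Lemma arcosh_inj : {in [pred t : R | 1 <= t] &, injective arcosh}.
Proof.
have pos (t : R) : 1 <= t -> 0 < t + Num.sqrt (t ^+ 2 - 1).
  by move=> ?; rewrite ltr_wpDr ?sqrtr_ge0 // (lt_le_trans ltr01).
have mono (s t : R) : 1 <= s -> s < t ->
    s + Num.sqrt (s ^+ 2 - 1) < t + Num.sqrt (t ^+ 2 - 1).
  move=> s1 st; rewrite ltr_leD // ler_wsqrtr // lerB // ler_sqr ?nnegrE; lra.
move=> s t; rewrite !inE => s1 t1 /ln_inj.
rewrite !posrE => /(_ (pos _ s1) (pos _ t1)) e.
by have [/(mono _ _ s1)|/(mono _ _ t1)|//] := ltgtP s t; rewrite e ltxx.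
Qed.

(** Injectivity of [arcosh] reduces equal distances to equal fractions, and denominators are
    positive in the ball. All later arguments about [hdist] go through this polynomial form. *)
Lemma eq_hdistE x y x' y' :
    unit_ball x -> unit_ball y -> unit_ball x' -> unit_ball y' ->
  hdist x y = hdist x' y' <->
  dotv (x - y) (x - y) * ((1 - dotv x' x') * (1 - dotv y' y')) =
  dotv (x' - y') (x' - y') * ((1 - dotv x x) * (1 - dotv y y)).
Proof.
rewrite !unit_ballE => bx bY bx' bY'.
have pos (z w : 'rV[R]_n) : dotv z z < 1 -> dotv w w < 1 ->
  0 < (1 - dotv z z) * (1 - dotv w w) by move=> *; rewrite mulr_gt0 ?subr_gt0.
have nz z w b b' := lt0r_neq0 (pos z w b b').
have in1 (z w : 'rV[R]_n) : dotv z z < 1 -> dotv w w < 1 ->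
  1 + 2 * dotv (z - w) (z - w) / ((1 - dotv z z) * (1 - dotv w w))
    \in [pred t : R | 1 <= t].
  move=> /pos h /h p; rewrite inE lerDl divr_ge0 ?(ltW p) //.
  by rewrite mulr_ge0 ?dotv_ge0.
rewrite /hdist !enorm_sqr; split => [/arcosh_inj|] e.
  have := addrI _ (e (in1 _ _ bx bY) (in1 _ _ bx' bY')).
  move/eqP; rewrite eqr_div ?nz // -!mulrA => /eqP/mulfI; apply.
  by rewrite pnatr_eq0.
congr (arcosh (1 + _)); apply/eqP; rewrite eqr_div ?nz //.
by rewrite -!(mulrA 2) e.
Qed.

Lemma eq_hdist0 x y : unit_ball x -> unit_ball y ->
  hdist x 0 = hdist y 0 <-> dotv x x = dotv y y.
Proof.
move=> bx bY; have b0 := @unit_ball0 R n.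
rewrite eq_hdistE //.
rewrite !subr0 dot0v subr0 !mulr1; split=> [e|->//]; lra.
Qed.

Lemma hdistC x y : hdist x y = hdist y x.
Proof.
rewrite /hdist -(opprB y x) !enorm_sqr dotvNl dotvNr opprK.
by rewrite [_ * (1 - dotv y y)]mulrC.
Qed.

(** The part of [hyp_isometry] that passes at once to composites and to maps agreeing on the
    ball. *)
Definition hyp_embedding f :=
  {homo f : x / unit_ball x} /\
  {in unit_ball &, forall x y, hdist (f x) (f y) = hdist x y}.

Lemma hyp_embedding_eq f x y : hyp_embedding f -> unit_ball x -> unit_ball y ->
  dotv (f x - f y) (f x - f y) * ((1 - dotv x x) * (1 - dotv y y)) =
  dotv (x - y) (x - y) * ((1 - dotv (f x) (f x)) * (1 - dotv (f y) (f y))).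
Proof.
move=> [fB fd] bx bY; apply/eq_hdistE => //; [exact: fB|exact: fB|].
by apply: fd; rewrite inE.
Qed.

(** Distances to the fixed point 0 give preservation of norms; the distance identity then gives |f x
    - f y| = |x - y|, and polarization concludes. *)
Lemma hyp_embedding_dotv f x y : hyp_embedding f -> f 0 = 0 ->
  unit_ball x -> unit_ball y -> dotv (f x) (f y) = dotv x y.
Proof.
move=> fe f0.
have norm z : unit_ball z -> dotv (f z) (f z) = dotv z z.
  move=> bz; have := hyp_embedding_eq fe bz unit_ball0.
  rewrite f0 !subr0 dot0v => e; lra.
move=> bx bY; have := hyp_embedding_eq fe bx bY.
rewrite !norm // => /mulIf; rewrite !dotvE !norm // mulf_neq0.
  move=> /(_ isT); rewrite (dotvC y) (dotvC (f y)) => e; lra.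
all: by rewrite subr_eq0 gt_eqF // -unit_ballE.
Qed.

End hyperbolic_distance.

(** * Differentiability at a point: locality and default value *)

Section differentiability.
Context {R : numFieldType} {V W : normedModType R}.
Implicit Types (f g : V -> W) (x : V).

(** The first-order expansion depends only on the germ at [x], so ['d f x] also serves as
    differential of [g]. *)
Lemma near_eq_differentiable f g x :
  (\near x, f x = g x) -> differentiable f x -> differentiable g x.
Proof.
move=> fg df; have fgx : f x = g x := nbhs_singleton fg.
have cdf : continuous ('d f x) by exact: diff_continuous.
have E : g \o shift x = cst (g x) + 'd f x +o_ 0 id.
  have [_ /eqaddoP H] := (diff_locallyP x f).1 df.
  have c : (fun h => h + x) @ (0 : V) --> (0 : V) + x.
    by apply: cvgD; [exact: cvg_id|exact: cvg_cst].
  rewrite add0r in c.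
  apply/eqaddoP => e e0; near=> h.
  have fgh : f (h + x) = g (h + x) by near: h; exact: (c _ fg).
  have : `|(f \o shift x - (cst (f x) + 'd f x)) h| <= e * `|h|.
    by near: h; exact: H.
  by rewrite !fctE /= fgh fgx.
by apply/diff_locallyP; rewrite (diff_unique cdf E).
Unshelve. all: by end_near. Qed.

(** ['d f x] is picked by [get]: any admissible candidate would make [f] differentiable, so [get]
    falls back to its default. *)
Lemma diff_not_differentiable f x : ~ differentiable f x -> 'd f x = point.
Proof.
move=> nd; rewrite /diff; set P := (X in get X).
apply: getPN => df Pdf; apply: nd; apply/diffP; rewrite /diff -/P.
exact: (@getI _ P df Pdf).
Qed.

End differentiability.

(** * The infinitesimal form of distance preservation *)

Section conformality.
Context {R : realType} {n : nat}.
Implicit Types (x v : 'rV[R]_n) (f : 'rV[R]_n -> 'rV[R]_n).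

Lemma unit_ball_open x : unit_ball x -> \near x, unit_ball x.
Proof.
rewrite unit_ballE => bx.
have : (fun y => dotv y y) @ x --> dotv x x.
  have cx : id @ x --> x by exact: cvg_id.
  exact: (cvg_dotv cx cx).
move/cvgr_lt => /(_ _ bx); apply: filterS => y.
by rewrite unit_ballE.
Qed.

(** Divide the distance identity for the points [h *: v + x] and [x] by [h ^+ 2] and let [h] tend to
    0: the difference quotient tends to ['d f x v]. *)
Lemma hyp_embedding_diff f x v :
  hyp_embedding f -> unit_ball x -> differentiable f x ->
  dotv ('d f x v) ('d f x v) * (1 - dotv x x) ^+ 2 =
  dotv v v * (1 - dotv (f x) (f x)) ^+ 2.
Proof.
move=> fe bx df.
have cy : (fun h : R => h *: v + x) @ 0^' --> x.
  have c : (fun h : R => h *: v + x) @ (0 : R) --> 0 *: v + x.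
    by apply: cvgD; [exact: scalel_continuous|exact: cvg_cst].
  by rewrite scale0r add0r in c; exact: cvg_within_filter c.
have cf : (fun h : R => f (h *: v + x)) @ 0^' --> f x.
  exact: cvg_comp cy (differentiable_continuous df).
have cq : (fun h : R => h^-1 *: (f (h *: v + x) - f x)) @ 0^' --> 'd f x v.
  by rewrite -deriveE //; exact: diff_derivable.
have c1 (u : R -> 'rV[R]_n) y : u @ 0^' --> y ->
    (fun h => 1 - dotv (u h) (u h)) @ 0^' --> 1 - dotv y y.
  by move=> uy; apply: cvgB; [exact: cvg_cst|exact: cvg_dotv].
have L : (fun h : R =>
    dotv (h^-1 *: (f (h *: v + x) - f x)) (h^-1 *: (f (h *: v + x) - f x))
    * ((1 - dotv (h *: v + x) (h *: v + x)) * (1 - dotv x x))) @ 0^' -->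
    dotv ('d f x v) ('d f x v) * ((1 - dotv x x) * (1 - dotv x x)).
  apply: cvgM; first exact: cvg_dotv.
  by apply: cvgM; [exact: c1|exact: cvg_cst].
have L' : (fun h : R => dotv v v
    * ((1 - dotv (f (h *: v + x)) (f (h *: v + x))) * (1 - dotv (f x) (f x))))
    @ 0^' -->
    dotv v v * ((1 - dotv (f x) (f x)) * (1 - dotv (f x) (f x))).
  by apply: cvgM; [exact: cvg_cst|apply: cvgM; [exact: c1|exact: cvg_cst]].
rewrite !expr2; apply: (cvg_unique _ _ L'); first exact: Rhausdorff.
apply: cvg_trans L; apply: near_eq_cvg; near=> h.
have h0 : h != 0 by near: h; exact: nbhs_dnbhs_neq.
have bh : unit_ball (h *: v + x).
  by near: h; exact: (cy _ (unit_ball_open bx)).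
have := hyp_embedding_eq fe bh bx; rewrite addrK.
set D := f _ - f x; rewrite !(dotvZl, dotvZr) => e.
rewrite [LHS](_ : _ = h^-1 ^+ 2 *
  (dotv D D * ((1 - dotv (h *: v + x) (h *: v + x)) * (1 - dotv x x)))).
  by rewrite e; field.
ring.
Unshelve. all: by end_near. Qed.

End conformality.

(* The library's default for ['d f x] is 0 where [f] is not differentiable. *)
Lemma det_jacobian_differentiable {R : realType} {n : nat}
    (f : 'rV[R]_n -> 'rV[R]_n) x :
  (0 < n)%N -> \det (jacobian f x) != 0 -> differentiable f x.
Proof.
case: n f x => // n f x _ dJ; apply: contrapT.
move=> /diff_not_differentiable df0; move: dJ; rewrite /jacobian df0.
have -> : lin1_mx (point : {linear 'rV[R]_n.+1 -> 'rV[R]_n.+1}) = 0.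
  by apply/matrixP => i j; rewrite !mxE.
by rewrite det0 eqxx.
Qed.

(** * Inversions in spheres orthogonal to the unit sphere *)

Section inversion.
Context {R : realType} {n : nat} (a : 'rV[R]_n) (s : R).
Context (s0 : 0 < s) (ha : dotv a a = 1 + s).
Implicit Types x y : 'rV[R]_n.

(** Here [s] is the squared radius, and [ha] expresses orthogonality to the unit sphere. The center,
    sent to infinity by [sphere_inversion], is fixed here since [x - a] vanishes. *)
Definition inversion x : 'rV[R]_n :=
  a + (s / dotv (x - a) (x - a)) *: (x - a).

Lemma sphere_inversionE x : x != a ->
  sphere_inversion a (Num.sqrt s) (Some x) = Some (inversion x).
Proof.
move=> /negPf xa; rewrite /= xa /inversion.
by rewrite expr_div_n sqr_sqrtr ?enorm_sqr // ltW.
Qed.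

Lemma unit_ball_neq_center x : unit_ball x -> x != a.
Proof.
rewrite unit_ballE => bx; apply/eqP => xa; move: bx.
by rewrite xa ha gtrDl ltNge ltW.
Qed.

Lemma inversion_dotvB x y : x != a -> y != a ->
  dotv (inversion x - inversion y) (inversion x - inversion y) =
  s ^+ 2 * dotv (x - y) (x - y) /
    (dotv (x - a) (x - a) * dotv (y - a) (y - a)).
Proof.
rewrite -!(subr_eq0 _ a) -!dotv_eq0.
have -> : inversion x - inversion y = (s / dotv (x - a) (x - a)) *: (x - a)
   - (s / dotv (y - a) (y - a)) *: (y - a).
  by rewrite /inversion opprD addrACA subrr add0r.
have -> : x - y = (x - a) - (y - a) by rewrite opprB addrA subrK.
move: (x - a) (y - a) => u w u0 w0.
rewrite !dotvE (dotvC w u).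
by field; rewrite u0 w0.
Qed.

(** Orthogonality makes 1 - |x|^2 scale by exactly the conformal factor s / |x - a|^2 of the
    inversion. *)
Lemma inversion_dotv x : x != a ->
  1 - dotv (inversion x) (inversion x) =
  s / dotv (x - a) (x - a) * (1 - dotv x x).
Proof.
rewrite -(subr_eq0 _ a) -dotv_eq0.
have -> : dotv x x = dotv (x - a + a) (x - a + a) by rewrite subrK.
rewrite /inversion; move: (x - a) => u u0.
by rewrite !dotvE (dotvC u a) ha; field.
Qed.

Lemma inversionK x : x != a -> inversion (inversion x) = x.
Proof.
rewrite -(subr_eq0 _ a) -dotv_eq0 => u0.
rewrite {1}/inversion; have -> : inversion x - a =
  (s / dotv (x - a) (x - a)) *: (x - a) by rewrite /inversion addrC addKr.
rewrite dotvZl dotvZr scalerA -[RHS](subrKC a); congr (a + _).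
rewrite -[RHS]scale1r; congr (_ *: _); field.
by rewrite u0 gt_eqF.
Qed.

Lemma unit_ball_inversion x : unit_ball x -> unit_ball (inversion x).
Proof.
move=> bx; have xa := unit_ball_neq_center bx.
rewrite unit_ballE -subr_gt0 inversion_dotv // mulr_gt0 //.
  by rewrite divr_gt0 // dotv_gt0 subr_eq0.
by rewrite subr_gt0 -unit_ballE.
Qed.

(** The conformal factors at [x] and [y] multiply both |x - y|^2 and (1 - |x|^2)(1 - |y|^2), hence
    cancel in the distance. *)
Lemma hyp_embedding_inversion : hyp_embedding inversion.
Proof.
split=> [x|x y]; first exact: unit_ball_inversion.
rewrite !inE => bx bY.
have xa := unit_ball_neq_center bx; have ya := unit_ball_neq_center bY.
apply/eq_hdistE => //; try exact: unit_ball_inversion.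
rewrite inversion_dotvB // !inversion_dotv //.
move: xa ya; rewrite -!(subr_eq0 _ a) -!dotv_eq0 => xa ya.
by field; rewrite xa ya.
Qed.

End inversion.

(** * Maps preserving inner products as products of reflections *)

Section mobius_orthogonal.
Context {R : realType} {n : nat}.
Local Notation E := 'rV[R]_n.
Local Notation Ehat := (one_point_compactification E).
Implicit Types (x y d : E) (h : E -> E) (g : Ehat -> Ehat) (A : 'M[R]_n).

(** Reflection in the hyperplane orthogonal to [d], acting on row vectors from the right; [d] need
    not have length 1. *)
Definition reflection_mx d : 'M[R]_n :=
  1%:M - (2 / dotv d d) *: (d^T *m d).

Lemma mul_reflection_mx d x :
  x *m reflection_mx d = x - (2 * dotv x d / dotv d d) *: d.
Proof.
rewrite mulmxBr mulmx1 -scalemxAr mulmxA (mx11_scalar (x *m d^T)).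
by rewrite mul_scalar_mx -dotv_mulmx scalerA mulrAC.
Qed.

Lemma isometry_reflection_mx d : d != 0 -> isometry_mx (reflection_mx d).
Proof.
rewrite -dotv_eq0 => d0 x y; rewrite !mul_reflection_mx !dotvE (dotvC d y).
by field.
Qed.

Lemma hyperplane_reflectionE d x : d != 0 ->
  hyperplane_reflection ((enorm d)^-1 *: d) 0 (Some x) =
  Some (x *m reflection_mx d).
Proof.
rewrite -dotv_eq0 => d0; rewrite mul_reflection_mx /= dotvZr scalerA.
rewrite -(scaleNr _ d); congr Some; congr (x + _ *: d).
rewrite -enorm_sqr; field.
by rewrite -sqrf_eq0 enorm_sqr.
Qed.

Lemma enorm_normalize d : d != 0 -> enorm ((enorm d)^-1 *: d) = 1.
Proof.
rewrite -dotv_eq0 => d0; rewrite /enorm dotvZl dotvZr -/(enorm d) -enorm_sqr.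
rewrite mulrA -expr2 exprVn mulVf ?sqrtr1 //.
by rewrite enorm_sqr.
Qed.

(* The reflection exchanging [y] and [z] fixes the vectors having the same inner
   product with [y] and [z], so the images of the basis vectors can be corrected
   one after the other. *)
Lemma mobius_extends_isometry h g0 :
  {in unit_ball &, forall x y, dotv (h x) (h y) = dotv x y} -> mobius g0 ->
  exists g A, [/\ mobius g,
    forall z x, g0 z = Some x -> g z = Some (x *m A)
    & {in unit_ball, forall x, h x = x *m A}].
Proof.
(* Basis vectors are halved to lie in the open ball, where [hh] applies. *)
move=> hh mg0; pose q (i : 'I_n) : E := 2^-1 *: delta_mx 0 i.
have bq i : q i \in unit_ball.
  rewrite inE unit_ballE dotvZl dotvZr dotv_delta mxE !eqxx /=; lra.
have step k : (k <= n)%N -> exists g A, [/\ mobius g,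
    forall z x, g0 z = Some x -> g z = Some (x *m A), isometry_mx A
    & forall i : 'I_n, (i < k)%N -> h (q i) = q i *m A].
  elim: k => [_|k IH kn].
    exists g0, 1%:M; split=> // [z x ->|x y]; by rewrite !mulmx1.
  have [g [A [mg gA iA qA]]] := IH (ltnW kn).
  pose i0 := Ordinal kn; pose d := q i0 *m A - h (q i0).
  have [d0|d0] := eqVneq d 0.
    exists g, A; split=> // i; rewrite ltnS leq_eqVlt => /orP[/eqP ik|/qA //].
    have -> : i = i0 by exact: val_inj.
    by move/eqP: d0; rewrite subr_eq0 => /eqP.
  exists (hyperplane_reflection ((enorm d)^-1 *: d) 0 \o g).
  exists (A *m reflection_mx d); split.
  - by apply: mobius_hyperplane => //; exact: enorm_normalize.
  - by move=> z x /gA gz; rewrite /comp gz hyperplane_reflectionE // mulmxA.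
  - by move=> x y; rewrite !mulmxA isometry_reflection_mx.
  move=> i; rewrite mulmxA mul_reflection_mx ltnS leq_eqVlt.
  move=> /orP[/eqP ik|ik].
    have -> : i = i0 by exact: val_inj.
    have hq : dotv (h (q i0)) (h (q i0)) = dotv (q i0 *m A) (q i0 *m A).
      by rewrite hh // iA.
    (* For y and z of equal norm, 2<y, y - z> = |y - z|^2, so the reflection along y - z sends y to
       z. *)
    have -> : 2 * dotv (q i0 *m A) d = dotv d d.
      rewrite /d !dotvE hq (dotvC (h (q i0))); lra.
    by rewrite divff ?dotv_eq0 // scale1r subKr.
  rewrite {1}/d dotvDr dotvNr iA -(qA i ik) hh // subrr.
  by rewrite mulr0 mul0r scale0r subr0.
have [g [A [mg gA iA qA]]] := step n (leqnn n).
exists g, A; split=> // x bx; apply/eqP; rewrite -subr_eq0; apply/eqP.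
have uA := isometry_unitmx iA.
(* Pulling [h x - x *m A] back by [A] turns the coordinates of [w] into inner products with
   [delta_mx 0 i *m A], a multiple of [h (q i)]; these vanish as [h] and [A] both preserve inner
   products. *)
rewrite -[LHS](mulmxKV uA); set w := _ *m invmx A.
suff -> : w = 0 by rewrite mul0mx.
apply/rowP => i; rewrite [RHS]mxE -dotv_delta -iA mulmxKV //.
have -> : delta_mx 0 i *m A = 2 *: h (q i).
  by rewrite qA // /q -scalemxAl scalerA mulfV ?scale1r // pnatr_eq0.
by rewrite dotvZr dotvDl dotvNl hh // qA // iA subrr mulr0.
Qed.

End mobius_orthogonal.

(** * Bisectors, conformal factor 1 and the Mobius extension *)

Section isometric_sphere.
Context {R : realType} {n : nat}.
Implicit Types (f : 'rV[R]_n -> 'rV[R]_n) (u p : 'rV[R]_n).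

Lemma hyp_embedding_bisector f p u :
    hyp_embedding f -> unit_ball p -> unit_ball u -> f p = 0 ->
  hdist 0 u = hdist u p <-> dotv (f u) (f u) = dotv u u.
Proof.
move=> [fB fd] bp bu fp; rewrite hdistC -(fd u p) ?inE // fp.
by rewrite (eq_hdist0 bu (fB _ bu)); split=> ->.
Qed.

Lemma hyp_embedding_conformal1 f u :
    (0 < n)%N -> hyp_embedding f -> unit_ball u -> differentiable f u ->
  (forall v, enorm ('d f u v) = 1 * enorm v) <-> dotv (f u) (f u) = dotv u u.
Proof.
move=> n0 fe bu df; have dfe v := hyp_embedding_diff v fe bu df.
have bfu : dotv (f u) (f u) < 1 by rewrite -unit_ballE; exact: fe.1.
have bu' : dotv u u < 1 by rewrite -unit_ballE.
split=> [h|e v].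
  (* A vector of length 1 reduces the identity to an equality of squares of the positive numbers 1 -
     |u|^2 and 1 - |f u|^2. *)
  pose v : 'rV[R]_n := delta_mx 0 (Ordinal n0).
  have := dfe v; rewrite -!enorm_sqr h mul1r enorm_sqr dotv_delta mxE !eqxx.
  rewrite !enorm_sqr !mul1r => /eqP; rewrite eqrXn2 //; [|lra|lra].
  by move=> /eqP; lra.
have := dfe v; rewrite e => /mulIf; rewrite mul1r /enorm => -> //.
rewrite expf_neq0 //; apply/eqP; lra.
Qed.

Lemma hyp_embedding_comp f g :
  hyp_embedding f -> hyp_embedding g -> hyp_embedding (f \o g).
Proof.
move=> [fB fd] [gB gd]; split=> [x /gB /fB //|x y].
rewrite !inE => bx bY /=; rewrite fd ?gd ?inE //; exact: gB.
Qed.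

Lemma eq_hyp_embedding f g : {in unit_ball, f =1 g} ->
  hyp_embedding f -> hyp_embedding g.
Proof.
move=> fg [fB fd]; split=> [x bx|x y bx bY].
  by rewrite -fg ?inE //; exact: fB.
by rewrite -!fg // fd.
Qed.

Lemma mobius_extension_exists f p :
    hyp_embedding f -> unit_ball p -> p != 0 -> f p = 0 ->
  exists g, mobius_extension f g.
Proof.
move=> fe; rewrite unit_ballE => bp p0 fp.
have pp0 : 0 < dotv p p by rewrite dotv_gt0.
(* The sphere orthogonal to the unit sphere whose inversion exchanges 0 and [p]: its center is p /
   |p|^2, and orthogonality forces s = |a|^2 - 1. *)
pose s := (dotv p p)^-1 - 1; pose a := (dotv p p)^-1 *: p.
have s0 : 0 < s by rewrite subr_gt0 invf_gt1.
have ha : dotv a a = 1 + s.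
  by rewrite /a /s dotvZl dotvZr mulVf ?gt_eqF // mulr1 subrKC.
have ip : inversion a s 0 = p.
  rewrite /inversion sub0r dotvNl dotvNr opprK ha scalerN -scaleNr.
  rewrite -[X in X + _]scale1r -scalerDl /a scalerA /s -[RHS]scale1r.
  congr (_ *: _); rewrite subrKC; field.
  by rewrite gt_eqF.
have ie := hyp_embedding_inversion s0 ha.
have he := hyp_embedding_comp fe ie.
have h0 : (f \o inversion a s) 0 = 0 by rewrite /= ip.
have mi : mobius (sphere_inversion a (Num.sqrt s) \o id).
  by apply: mobius_sphere; [rewrite sqrtr_gt0|exact: mobius_id].
have [|g [A [mg gA hA]]] :=
  mobius_extends_isometry (h := f \o inversion a s) _ mi.
  by move=> x y; rewrite !inE; exact: hyp_embedding_dotv.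
exists g; split=> // x; rewrite inE => bx.
have xa := unit_ball_neq_center s0 ha bx.
(* Since the inversion is an involution, [f x] is the value of [f \o inversion a s] at
   [inversion a s x]. *)
rewrite (gA _ (inversion a s x)); last by rewrite -sphere_inversionE.
rewrite -hA ?inE; last exact: unit_ball_inversion.
by rewrite /= inversionK.
Qed.

End isometric_sphere.

Theorem theorem2p5 (R : realType) (n : nat) (gamma : 'rV[R]_n -> 'rV[R]_n)
    (hn : (2 <= n)%N)
    (hiso : hyp_isometry gamma)
    (hor : orientation_preserving gamma)
    (h0 : gamma 0 <> 0) :
  isometric_sphere gamma `&` unit_ball =
  [set u | unit_ball u /\ hdist 0 u = hdist u (pinv unit_ball gamma 0)].
Proof.
have n0 : (0 < n)%N := ltnW hn.
case: hiso => gbij gd; set p := pinv unit_ball gamma 0.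
have ge : hyp_embedding gamma by split=> //; have [] := gbij.
have bp : unit_ball p.
  by have [+ _ _] := bijpinv_bij (fun=> point) gbij; apply; exact: unit_ball0.
have gp : gamma p = 0.
  have [_ _ gs] := gbij; apply: (surjpK _ gs).
  by rewrite inE; exact: unit_ball0.
have p0 : p != 0 by apply/eqP => p0; apply: h0; rewrite -p0 gp.
(* The finite part of any extension thus inherits [hyp_embedding], so its conformal factor can be
   computed. *)
have fin g : mobius_extension gamma g -> {in unit_ball, gamma =1 finite_part g}.
  by move=> [_ gE] x bx; rewrite /finite_part gE.
apply/seteqP; split=> u /=.
  move=> [[g gg [_ dg cg]] bu]; split=> //.
  apply/(hyp_embedding_bisector ge bp bu gp).
  have fe := eq_hyp_embedding (fin _ gg) ge.
  rewrite (fin _ gg) ?inE //.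
  exact/(hyp_embedding_conformal1 n0 fe bu dg).
move=> [bu /(hyp_embedding_bisector ge bp bu gp) e]; split=> //.
have [g gg] := mobius_extension_exists ge bp p0 gp.
have fe := eq_hyp_embedding (fin _ gg) ge.
(* Preservation of orientation makes the Jacobian determinant of [gamma] nonzero, hence [gamma]
   differentiable at [u]; this carries over since both maps agree near [u]. *)
have dg : differentiable (finite_part g) u.
  apply: near_eq_differentiable; last first.
    apply: (det_jacobian_differentiable n0); rewrite gt_eqF //.
    by apply: (hor u); rewrite inE.
  by apply: filterS (unit_ball_open bu) => x bx; apply: (fin _ gg); rewrite inE.
exists g => //; split=> //; first by rewrite gg.2 ?inE.
by apply/(hyp_embedding_conformal1 n0 fe bu dg); rewrite -(fin _ gg) ?inE.
Qed.
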